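(* The following assertions are equivalent for a functor $F:\mathcal{C}\to\mathcal{D}$. (1) $F$ is separable; (2) $F$ is semiseparable and Maschke; (3) $F$ is semiseparable and dual Maschke; (4) $F$ is semiseparable and conservative.
   Context: For a functor $F:\mathcal{C}\to\mathcal{D}$ let $\mathcal{F}^F:\mathrm{Hom}_{\mathcal{C}}(-,-)\to\mathrm{Hom}_{\mathcal{D}}(F-,F-)$ be the natural transformation (of functors $\mathcal{C}^{\mathrm{op}}\times\mathcal{C}\to\mathsf{Set}$) with $\mathcal{F}^F_{X,Y}(f)=F(f)$. $F$ is separable if there is a natural transformation $\mathcal{P}^F:\mathrm{Hom}_{\mathcal{D}}(F-,F-)\to\mathrm{Hom}_{\mathcal{C}}(-,-)$ with $\mathcal{P}^F\circ\mathcal{F}^F=\mathrm{Id}$; semiseparable if there is such a $\mathcal{P}^F$ with $\mathcal{F}^F\circ\mathcal{P}^F\circ\mathcal{F}^F=\mathcal{F}^F$. $F$ is a Maschke functor if it reflects split monomorphisms (whenever $Fi$ is a split monomorphism, so is $i$), a dual Maschke functor if it reflects split epimorphisms, and conservative if it reflects isomorphisms. *)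

(* Defs.v *)
From Stdlib Require Import FunctionalExtensionality.
From mathcomp Require Import all_boot.

Set Implicit Arguments.
Unset Strict Implicit.
Unset Printing Implicit Defensive.

Declare Scope cat_scope.
Delimit Scope cat_scope with cat.
Local Open Scope cat_scope.

(* Hom-sets are types, and equality of morphisms is Leibniz equality. *)
Record category := Category {
  ob :> Type;
  hom : ob -> ob -> Type;
  idm : forall X, hom X X;
  compm : forall X Y Z, hom Y Z -> hom X Y -> hom X Z;
  compmA : forall X Y Z T (h : hom Z T) (g : hom Y Z) (f : hom X Y),
    compm h (compm g f) = compm (compm h g) f;
  comp1m : forall X Y (f : hom X Y), compm (idm Y) f = f;
  compm1 : forall X Y (f : hom X Y), compm f (idm X) = f }.

Arguments idm {c} X.
Notation "g \o f" := (compm g f) : cat_scope.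

Record functor (C D : category) := Functor {
  fob :> C -> D;
  fhom : forall X Y : C, hom X Y -> hom (fob X) (fob Y);
  fhom1 : forall X : C, fhom (idm X) = idm (fob X);
  fhomM : forall (X Y Z : C) (g : hom Y Z) (f : hom X Y),
    fhom (g \o f) = fhom g \o fhom f }.

Record nat_trans (C D : category) (F G : functor C D) := NatTrans {
  component :> forall X : C, hom (F X) (G X);
  naturality : forall (X Y : C) (f : hom X Y),
    component Y \o fhom F f = fhom G f \o component X }.

Section NatTransCategory.
Variables (C D : category).

Lemma nt_id_natural (F : functor C D) (X Y : C) (f : hom X Y) :
  idm (F Y) \o fhom F f = fhom F f \o idm (F X).
Proof. by rewrite comp1m compm1. Qed.

Definition nt_id (F : functor C D) : nat_trans F F :=
  NatTrans (@nt_id_natural F).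

Lemma nt_comp_natural (F G H : functor C D)
    (b : nat_trans G H) (a : nat_trans F G) (X Y : C) (f : hom X Y) :
  (b Y \o a Y) \o fhom F f = fhom H f \o (b X \o a X).
Proof. by rewrite -compmA naturality compmA naturality compmA. Qed.

Definition nt_comp (F G H : functor C D)
    (b : nat_trans G H) (a : nat_trans F G) : nat_trans F H :=
  NatTrans (nt_comp_natural b a).

End NatTransCategory.

Section FunctorComp.
Variables (C D E : category) (G : functor D E) (F : functor C D).

Lemma functor_comp1 (X : C) : fhom G (fhom F (idm X)) = idm (G (F X)).
Proof. by rewrite !fhom1. Qed.

Lemma functor_compM (X Y Z : C) (g : hom Y Z) (f : hom X Y) :
  fhom G (fhom F (g \o f)) = fhom G (fhom F g) \o fhom G (fhom F f).
Proof. by rewrite !fhomM. Qed.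

Definition functor_comp : functor C E :=
  @Functor C E (fun X => G (F X)) (fun X Y f => fhom G (fhom F f))
    functor_comp1 functor_compM.

End FunctorComp.

Definition op_cat (C : category) : category :=
  @Category C (fun X Y => hom Y X) (fun X => idm X)
    (fun X Y Z g f => f \o g)
    (fun X Y Z T h g f => esym (compmA f g h))
    (fun X Y f => compm1 f) (fun X Y f => comp1m f).

Definition op_functor (C D : category) (F : functor C D) :
    functor (op_cat C) (op_cat D) :=
  @Functor (op_cat C) (op_cat D) F (fun X Y f => fhom F f)
    (fun X => fhom1 F X) (fun X Y Z g f => fhomM F f g).

Section Product.
Variables (C D : category).

Definition prod_hom (X Y : C * D) : Type := hom X.1 Y.1 * hom X.2 Y.2.

Definition prod_comp (X Y Z : C * D) (g : prod_hom Y Z) (f : prod_hom X Y) :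
  prod_hom X Z := (g.1 \o f.1, g.2 \o f.2).

Lemma prod_compA X Y Z T
    (h : prod_hom Z T) (g : prod_hom Y Z) (f : prod_hom X Y) :
  prod_comp h (prod_comp g f) = prod_comp (prod_comp h g) f.
Proof. by rewrite /prod_comp /= !compmA. Qed.

Lemma prod_comp1m X Y (f : prod_hom X Y) : prod_comp (idm Y.1, idm Y.2) f = f.
Proof. by case: f => f1 f2; rewrite /prod_comp /= !comp1m. Qed.

Lemma prod_compm1 X Y (f : prod_hom X Y) : prod_comp f (idm X.1, idm X.2) = f.
Proof. by case: f => f1 f2; rewrite /prod_comp /= !compm1. Qed.

Definition prod_cat : category :=
  @Category (C * D) prod_hom (fun X => (idm X.1, idm X.2)) prod_comp
    prod_compA prod_comp1m prod_compm1.

End Product.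

Section ProdFunctor.
Variables (C D C' D' : category) (F : functor C C') (G : functor D D').

Definition prod_fob (X : prod_cat C D) : prod_cat C' D' := (F X.1, G X.2).

Definition prod_fhom (X Y : prod_cat C D) (f : hom X Y) :
  hom (prod_fob X) (prod_fob Y) := (fhom F f.1, fhom G f.2).

Lemma prod_fhom1 (X : prod_cat C D) : prod_fhom (idm X) = idm (prod_fob X).
Proof. by rewrite /prod_fhom /= !fhom1. Qed.

Lemma prod_fhomM (X Y Z : prod_cat C D) (g : hom Y Z) (f : hom X Y) :
  prod_fhom (g \o f) = prod_fhom g \o prod_fhom f.
Proof. by rewrite /prod_fhom /= !fhomM. Qed.

Definition prod_functor : functor (prod_cat C D) (prod_cat C' D') :=
  Functor prod_fhom1 prod_fhomM.

End ProdFunctor.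

(* Types and functions play the role of the category of sets. *)
Definition set_cat : category :=
  @Category Type (fun A B => A -> B) (fun A x => x)
    (fun A B C g f x => g (f x))
    (fun _ _ _ _ _ _ _ => erefl) (fun _ _ _ => erefl) (fun _ _ _ => erefl).

Section HomFunctor.
Variable C : category.

Definition homf_ob (p : prod_cat (op_cat C) C) : set_cat := @hom C p.1 p.2.

Definition homf_hom (p q : prod_cat (op_cat C) C) (u : hom p q) :
  hom (homf_ob p) (homf_ob q) :=
  fun h : @hom C p.1 p.2 => (u.2 \o h) \o (u.1 : @hom C q.1 p.1).

Lemma homf_hom1 p : homf_hom (idm p) = idm (homf_ob p).
Proof.
apply: functional_extensionality_dep => h.
by rewrite /homf_hom /= comp1m compm1.
Qed.

Lemma homf_homM p q r (v : hom q r) (u : hom p q) :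
  homf_hom (v \o u) = homf_hom v \o homf_hom u.
Proof.
apply: functional_extensionality_dep => h.
by rewrite /homf_hom /= !compmA.
Qed.

Definition hom_functor : functor (prod_cat (op_cat C) C) set_cat :=
  Functor homf_hom1 homf_homM.

End HomFunctor.

Section Separability.
Variables (C D : category) (F : functor C D).

(* Hom_D(F-, F-), as the composite of Hom_D(-, -) with F^op x F. *)
Definition hom_functor_along : functor (prod_cat (op_cat C) C) set_cat :=
  functor_comp (hom_functor D) (prod_functor (op_functor F) F).

Definition hom_action (p : prod_cat (op_cat C) C) :
    hom (hom_functor C p) (hom_functor_along p) :=
  fun f : @hom C p.1 p.2 => fhom F f.
Arguments hom_action : clear implicits.

Lemma hom_action_natural (p q : prod_cat (op_cat C) C) (u : hom p q) :
  hom_action q \o fhom (hom_functor C) u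
  = fhom hom_functor_along u \o hom_action p.
Proof.
apply: functional_extensionality_dep => h.
by rewrite /= /hom_action /homf_hom /= !fhomM.
Qed.

Definition hom_nt : nat_trans (hom_functor C) hom_functor_along :=
  NatTrans hom_action_natural.

Definition separable : Prop :=
  exists P : nat_trans hom_functor_along (hom_functor C),
    nt_comp P hom_nt = nt_id (hom_functor C).

Definition semiseparable : Prop :=
  exists P : nat_trans hom_functor_along (hom_functor C),
    nt_comp hom_nt (nt_comp P hom_nt) = hom_nt.

End Separability.

Definition split_mono (C : category) (X Y : C) (i : hom X Y) : Prop :=
  exists r : hom Y X, r \o i = idm X.

Definition split_epi (C : category) (X Y : C) (p : hom X Y) : Prop :=
  exists s : hom Y X, p \o s = idm Y.

Definition isomorphism (C : category) (X Y : C) (f : hom X Y) : Prop :=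
  exists g : hom Y X, g \o f = idm X /\ f \o g = idm Y.

Section Reflection.
Variables (C D : category) (F : functor C D).

Definition maschke : Prop :=
  forall (X Y : C) (i : hom X Y), split_mono (fhom F i) -> split_mono i.

Definition dual_maschke : Prop :=
  forall (X Y : C) (p : hom X Y), split_epi (fhom F p) -> split_epi p.

Definition conservative : Prop :=
  forall (X Y : C) (f : hom X Y), isomorphism (fhom F f) -> isomorphism f.

End Reflection.

(* Main.v *)
Require Import Defs.
From Stdlib Require Import FunctionalExtensionality ProofIrrelevance.
From mathcomp Require Import all_boot.

(** If [P] witnesses semiseparability, the endomorphisms [e X := P (idm (F X))]
satisfy [P (F f) = f \o e X] and [F (e X) = idm (F X)], hence are idempotent.
Each of the three reflection properties makes [e X] split mono or split epi,
and such an idempotent is the identity; then [P (F f) = f]. Conversely, when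
[P (F f) = f], naturality of [P] carries one-sided inverses of [F f] to
one-sided inverses of [f]. *)

Set Implicit Arguments.
Unset Strict Implicit.
Unset Printing Implicit Defensive.

Local Open Scope cat_scope.

(** Proof irrelevance identifies the two naturality proofs, so only the components matter. This
    reduces the equations defining (semi)separability to equations between morphisms. *)
Lemma nat_trans_ext (C D : category) (F G : functor C D) (a b : nat_trans F G) :
  (forall X, a X = b X) -> a = b.
Proof.
case: a b => [a na] [b nb] /= eq_ab.
have {}eq_ab : a = b by apply: functional_extensionality_dep.
rewrite -{}eq_ab in nb *.
by rewrite (proof_irrelevance _ na nb).
Qed.

(** A retraction [r] cancels one factor: [e = (r \o e) \o e = r \o (e \o e) = r \o e = idm X]. *)
Lemma idempotent_split_mono (C : category) (X : C) (e : hom X X) :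
  e \o e = e -> split_mono e -> e = idm X.
Proof. by move=> ee [r re]; rewrite -(comp1m e) -re -compmA ee. Qed.

Lemma idempotent_split_epi (C : category) (X : C) (e : hom X X) :
  e \o e = e -> split_epi e -> e = idm X.
Proof. by move=> ee [s es]; rewrite -(compm1 e) -es compmA ee. Qed.

Lemma split_mono_idm (C : category) (X : C) : split_mono (idm X).
Proof. by exists (idm X); rewrite comp1m. Qed.

Lemma split_epi_idm (C : category) (X : C) : split_epi (idm X).
Proof. by exists (idm X); rewrite comp1m. Qed.

Lemma isomorphism_idm (C : category) (X : C) : isomorphism (idm X).
Proof. by exists (idm X); rewrite comp1m. Qed.

Lemma isomorphism_split_mono (C : category) (X Y : C) (f : hom X Y) :
  isomorphism f -> split_mono f.
Proof. by case=> g [gf _]; exists g. Qed.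

Section Retraction.
Variables (C D : category) (F : functor C D).
Variable P : nat_trans (hom_functor_along F) (hom_functor C).

Definition retr (X Y : C) (g : hom (F X) (F Y)) : hom X Y :=
  P ((X, Y) : prod_cat (op_cat C) C) g.

Lemma retr_compl (X Y Z : C) (h : hom Y Z) (g : hom (F X) (F Y)) :
  retr (fhom F h \o g) = h \o retr g.
Proof.
(* Only the covariant variable moves, along [h]. *)
have := naturality P (((idm X : @hom C X X), h) :
  @hom (prod_cat (op_cat C) C) (X, Y) (X, Z)).
move/(congr1 (fun k => k g)).
by rewrite /= /homf_hom /= fhom1 !compm1.
Qed.

Lemma retr_compr (X Y Z : C) (g : hom (F Y) (F Z)) (f : hom X Y) :
  retr (g \o fhom F f) = retr g \o f.
Proof.
(* Only the contravariant variable moves: [f] is read as a morphism from [Y] to [X] in the opposite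
   category. *)
have := naturality P (((f : @hom (op_cat C) Y X), idm Z) :
  @hom (prod_cat (op_cat C) C) (Y, Z) (X, Z)).
move/(congr1 (fun k => k g)).
by rewrite /= /homf_hom /= fhom1 !comp1m.
Qed.

Lemma retr_fhom (X Y : C) (f : hom X Y) :
  retr (fhom F f) = f \o retr (idm (F X)).
Proof. by rewrite -retr_compl compm1. Qed.

End Retraction.

Section Characterization.
Variables (C D : category) (F : functor C D).

Lemma separableP : separable F <->
  exists P : nat_trans (hom_functor_along F) (hom_functor C),
    forall (X Y : C) (f : hom X Y), retr P (fhom F f) = f.
Proof.
split=> -[P PF]; exists P.
  move=> X Y f.
  exact: (congr1 (fun a : nat_trans (hom_functor C) (hom_functor C) =>
    a ((X, Y) : prod_cat (op_cat C) C) f) PF).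
apply: nat_trans_ext => -[X Y]; apply: functional_extensionality_dep => f.
exact: PF.
Qed.

Lemma semiseparableP : semiseparable F <->
  exists P : nat_trans (hom_functor_along F) (hom_functor C),
    forall (X Y : C) (f : hom X Y), fhom F (retr P (fhom F f)) = fhom F f.
Proof.
split=> -[P FPF]; exists P.
  move=> X Y f.
  exact: (congr1 (fun a : nat_trans (hom_functor C) (hom_functor_along F) =>
    a ((X, Y) : prod_cat (op_cat C) C) f) FPF).
apply: nat_trans_ext => -[X Y]; apply: functional_extensionality_dep => f.
exact: FPF.
Qed.

Lemma separable_semiseparable : separable F -> semiseparable F.
Proof.
move=> /separableP[P PF]; apply/semiseparableP; exists P => X Y f.
by rewrite PF.
Qed.

Lemma separable_maschke : separable F -> maschke F.
Proof.
move=> /separableP[P PF] X Y i [r ri]; exists (retr P r).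
by rewrite -retr_compr ri -fhom1 PF.
Qed.

Lemma separable_dual_maschke : separable F -> dual_maschke F.
Proof.
move=> /separableP[P PF] X Y p [s ps]; exists (retr P s).
by rewrite -retr_compl ps -fhom1 PF.
Qed.

Lemma separable_conservative : separable F -> conservative F.
Proof.
move=> /separableP[P PF] X Y f [g [gf fg]]; exists (retr P g).
by rewrite -retr_compr -retr_compl gf fg -!fhom1 !PF.
Qed.

(** The hypothesis is what the three reflection properties have in common: an idempotent that [F]
    sends to an identity is itself an identity. It is applied to [retr P (idm (F X))]. *)
Lemma semiseparable_separable :
    (forall (X : C) (e : hom X X),
       e \o e = e -> fhom F e = idm (F X) -> e = idm X) ->
  semiseparable F -> separable F.
Proof.
move=> reflect_idm /semiseparableP[P FPF].
have Fe (X : C) : fhom F (retr P (idm (F X))) = idm (F X).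
  (* Semiseparability at [idm X], once the inner [idm (F X)] is written as [fhom F (idm X)]. *)
  by rewrite -{1}fhom1 FPF fhom1.
apply/separableP; exists P => X Y f.
rewrite retr_fhom (reflect_idm X (retr P (idm (F X)))) ?compm1 //.
(* Idempotence remains: with [e] for [retr P (idm (F X))], [e \o e = retr P (fhom F e) = retr P (idm
   (F X)) = e]. *)
by rewrite -retr_fhom Fe.
Qed.

Lemma semiseparable_maschke : semiseparable F -> maschke F -> separable F.
Proof.
move=> ssF mF; apply: semiseparable_separable ssF => X e ee Fe.
apply: idempotent_split_mono ee _; apply: mF; rewrite Fe.
exact: split_mono_idm.
Qed.

Lemma semiseparable_dual_maschke :
  semiseparable F -> dual_maschke F -> separable F.
Proof.
move=> ssF dF; apply: semiseparable_separable ssF => X e ee Fe.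
apply: idempotent_split_epi ee _; apply: dF; rewrite Fe.
exact: split_epi_idm.
Qed.

Lemma semiseparable_conservative :
  semiseparable F -> conservative F -> separable F.
Proof.
move=> ssF cF; apply: semiseparable_separable ssF => X e ee Fe.
apply: idempotent_split_mono ee _; apply: isomorphism_split_mono.
by apply: cF; rewrite Fe; apply: isomorphism_idm.
Qed.

End Characterization.

Theorem corollary1p9 (C D : category) (F : functor C D) :
  [<-> separable F;
       semiseparable F /\ maschke F;
       semiseparable F /\ dual_maschke F;
       semiseparable F /\ conservative F].
Proof.
(* The cycle of implications goes through separability each time: a semiseparable functor with one
   reflection property is separable, and so has the next property. *)
tfae.
- move=> sF; split; first exact: separable_semiseparable.
  exact: separable_maschke.
- move=> [ssF mF]; split=> //.
  by apply: separable_dual_maschke; apply: semiseparable_maschke.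
- move=> [ssF dF]; split=> //.
  by apply: separable_conservative; apply: semiseparable_dual_maschke.
- by move=> [ssF cF]; apply: semiseparable_conservative.
Qed.
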